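(* Let $n\ge 3$ be an integer and let $A_0>0$ be a real number. Among all simple $n$-gons in the plane $\mathbb{R}^2$ with area equal to $A_0$, the regular $n$-gon is the only minimizer of the perimeter. That is, for a simple $n$-gon $P^*\in\mathcal{P}_n$ with $A(P^* )=A_0$, one has $$L(P^* )=\min\{L(P) : P\in\mathcal{P}_n,\ A(P)=A_0\}$$ (the minimum being attained) if and only if $P^*$ is a regular $n$-gon.
   Context: A simple $n$-gon $P$ is given by $n$ distinct vertices $\mathbf{a}_0,\dots,\mathbf{a}_{n-1}\in\mathbb{R}^2$, $\mathbf{a}_i=(x_i,y_i)$ (indices modulo $n$), such that the closed polygonal line with edges $[\mathbf{a}_i,\mathbf{a}_{i+1}]$ has no self-intersections: consecutive edges meet only at their common vertex and non-consecutive edges are disjoint. Angles equal to $\pi$ at a vertex are allowed. The vertices are listed in counter-clockwise order. $\mathcal{P}_n$ denotes the class of all simple $n$-gons. The area and perimeter of $P$ are $$A(P)=\frac12\sum_{i=0}^{n-1}(x_iy_{i+1}-x_{i+1}y_i),\qquad L(P)=\sum_{i=0}^{n-1}\sqrt{(x_{i+1}-x_i)^2+(y_{i+1}-y_i)^2}.$$ With the counter-clockwise orientation, $A(P)$ is the area of the bounded region enclosed by the polygonal line. A simple $n$-gon is regular if all its edges have the same length and all its interior angles are equal; the regular $n$-gon of area $A_0$ is unique up to isometries of the plane (and cyclic relabelling of the vertices). *)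

(* Defs.v *)
From HB Require Import structures.
From mathcomp Require Import all_boot all_order all_algebra.
From mathcomp Require Import all_classical all_reals all_analysis.

Set Implicit Arguments.
Unset Strict Implicit.
Unset Printing Implicit Defensive.

Import Order.TTheory GRing.Theory Num.Theory.

Local Open Scope classical_set_scope.
Local Open Scope ring_scope.

(* A point of the plane is a pair of coordinates. The norm that the library
   puts on R * R is the sup norm, so Euclidean lengths are written out below.
   A polygon is its vertex map P : 'I_n -> R * R; ordS and ord_pred are the
   cyclic successor and predecessor on 'I_n. *)

Definition dot (R : realType) (u v : R * R) : R := u.1 * v.1 + u.2 * v.2.

Definition cross (R : realType) (u v : R * R) : R := u.1 * v.2 - v.1 * u.2.

Definition enorm (R : realType) (u : R * R) : R :=
  Num.sqrt (u.1 ^+ 2 + u.2 ^+ 2).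

Definition segment (R : realType) (a b : R * R) : set (R * R) :=
  [set ((1 - t) * a.1 + t * b.1, (1 - t) * a.2 + t * b.2)
     | t in [set t : R | 0 <= t <= 1]].

Definition edge (R : realType) (n : nat) (P : 'I_n -> R * R) (i : 'I_n) :
    set (R * R) :=
  segment (P i) (P (ordS i)).

Definition edge_length (R : realType) (n : nat) (P : 'I_n -> R * R)
    (i : 'I_n) : R :=
  enorm (P (ordS i) - P i).

Definition perimeter (R : realType) (n : nat) (P : 'I_n -> R * R) : R :=
  \sum_(i < n) edge_length P i.

Definition area (R : realType) (n : nat) (P : 'I_n -> R * R) : R :=
  2^-1 * \sum_(i < n) cross (P i) (P (ordS i)).

(* Counter-clockwise order is positivity of the signed (shoelace) area. *)
Definition simple_ngon (R : realType) (n : nat) (P : 'I_n -> R * R) : Prop :=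
  [/\ injective P,
      forall i, edge P i `&` edge P (ordS i) = [set P (ordS i)],
      forall i j, j != i -> j != ordS i -> i != ordS j ->
        edge P i `&` edge P j = set0
    & 0 < area P].

(* The angle in [0, 2 pi[ by which u must be turned counter-clockwise to have
   the direction of v (for u and v nonzero). *)
Definition ccw_angle (R : realType) (u v : R * R) : R :=
  let alpha := acos (dot u v / (enorm u * enorm v)) in
  if 0 <= cross u v then alpha else 2 * pi - alpha.

(* The interior of a counter-clockwise polygon lies to the left of its edges,
   hence is swept from the outgoing edge to the incoming one. *)
Definition interior_angle (R : realType) (n : nat) (P : 'I_n -> R * R)
    (i : 'I_n) : R :=
  ccw_angle (P (ordS i) - P i) (P (ord_pred i) - P i).

Definition regular_ngon (R : realType) (n : nat) (P : 'I_n -> R * R) : Prop :=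
  [/\ simple_ngon P,
      forall i j, edge_length P i = edge_length P j
    & forall i j, interior_angle P i = interior_angle P j].

Definition is_minimum (R : realType) (S : set R) (m : R) : Prop :=
  S m /\ lbound S m.

Definition perimeters (R : realType) (n : nat) (A0 : R) : set R :=
  [set perimeter P
     | P in [set P : 'I_n -> R * R | simple_ngon P /\ area P = A0]].

(* Main.v *)
(* The inequality [4 n tan(pi/n) A <= L^2] holds for every closed n-gon, simple
   or not. By compactness some n-gon maximizes the ratio A / L^2. At a maximizer
   consecutive edges have equal lengths: otherwise moving one vertex, with its
   neighbours fixed, to the apex of an isosceles triangle would increase the
   ratio. For equilateral n-gons L^2 is n times the sum of the squared edge
   lengths, and the inequality becomes a Wirtinger inequality, diagonalized by
   the discrete Fourier transform: in frequency k the defect has coefficient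
   4 sin(k pi/n) sin((k - 1) pi/n) >= 0, which vanishes only for k = 0, 1. Hence
   equality forces the vertices to be c + a w^j with w = exp(2 i pi/n).
   Conversely, a polygon with equal edges and equal angles is an orbit c + a v^j
   with v = w^m; positive area gives 2m < n, and for m > 1 two edges of this star
   polygon cross, so a simple one has m = 1. *)

Require Import Defs.
From mathcomp Require Import all_boot all_order all_algebra.
From mathcomp Require Import all_classical all_reals all_analysis.
From mathcomp Require Import ring lra zify.

Set Implicit Arguments.
Unset Strict Implicit.
Unset Printing Implicit Defensive.

Import Order.TTheory GRing.Theory Num.Theory.
Import numFieldNormedType.Exports.
(* Required last, so that [Re] and [Im] are the projections of [R[i]] rather
   than the homonyms of [numClosedFieldType]. *)
From mathcomp Require Import complex.

Local Open Scope classical_set_scope.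
Local Open Scope ring_scope.

(** * Closed polygons and the existence of an optimal one *)

Lemma enorm_ge0 (R : realType) (u : R * R) : 0 <= enorm u.
Proof. exact: sqrtr_ge0. Qed.

Lemma sqr_enorm (R : realType) (u : R * R) :
  enorm u ^+ 2 = u.1 ^+ 2 + u.2 ^+ 2.
Proof. by rewrite sqr_sqrtr // addr_ge0 // sqr_ge0. Qed.

Lemma enorm_eq0 (R : realType) (u : R * R) : enorm u = 0 -> u = 0.
Proof.
move=> u0; have := sqr_enorm u; rewrite u0 expr0n /= => /esym/eqP.
rewrite paddr_eq0 ?sqr_ge0 // !sqrf_eq0 => /andP[/eqP u1 /eqP u2].
by rewrite [u]surjective_pairing u1 u2.
Qed.

Lemma norm_fst_le_enorm (R : realType) (u : R * R) : `|u.1| <= enorm u.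
Proof.
rewrite -(@ler_pXn2r _ 2) ?nnegrE ?enorm_ge0 // sqr_enorm real_normK ?num_real //.
by rewrite lerDl sqr_ge0.
Qed.

Lemma norm_snd_le_enorm (R : realType) (u : R * R) : `|u.2| <= enorm u.
Proof.
rewrite -(@ler_pXn2r _ 2) ?nnegrE ?enorm_ge0 // sqr_enorm real_normK ?num_real //.
by rewrite lerDr sqr_ge0.
Qed.

Lemma edge_length_ge0 (R : realType) (n : nat) (P : 'I_n -> R * R) i :
  0 <= edge_length P i.
Proof. exact: enorm_ge0. Qed.

Lemma perimeter_ge0 (R : realType) (n : nat) (P : 'I_n -> R * R) :
  0 <= perimeter P.
Proof. by apply: sumr_ge0 => i _; exact: edge_length_ge0. Qed.

Lemma sum_ordS (V : nmodType) (n : nat) (F : 'I_n -> V) :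
  \sum_(i < n) F (ordS i) = \sum_(i < n) F i.
Proof. by rewrite [RHS](reindex_inj (@ordS_inj n)). Qed.

(** The point [t] goes to the origin before scaling, so one map covers both the normalization of the
    perimeter and the recentring of an orbit. *)
Definition homothety (R : realType) (n : nat) (c : R) (t : R * R)
    (P : 'I_n -> R * R) (i : 'I_n) : R * R :=
  (c * ((P i).1 - t.1), c * ((P i).2 - t.2)).

Lemma area_homothety (R : realType) (n : nat) c t (P : 'I_n -> R * R) :
  area (homothety c t P) = c ^+ 2 * area P.
Proof.
rewrite /area mulrCA; congr (_ * _); rewrite mulr_sumr.
(* The terms linear in [t] telescope around the cycle. *)
have t0 : \sum_(i < n) (cross t (P i) - cross t (P (ordS i))) = 0.
  by rewrite sumrB (sum_ordS (fun i => cross t (P i))) subrr.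
rewrite -[RHS]addr0 -[X in _ = _ + X](mulr0 (c ^+ 2)) -[X in _ = _ + _ * X]t0.
rewrite mulr_sumr -big_split /=.
by apply: eq_bigr => i _; rewrite /cross /homothety /=; ring.
Qed.

Lemma perimeter_homothety (R : realType) (n : nat) c t (P : 'I_n -> R * R) :
  0 <= c -> perimeter (homothety c t P) = c * perimeter P.
Proof.
move=> c0; rewrite /perimeter mulr_sumr; apply: eq_bigr => i _.
rewrite /edge_length /enorm /homothety /=.
rewrite -[c in RHS]ger0_norm // -sqrtr_sqr -sqrtrM ?sqr_ge0 //.
by congr Num.sqrt; ring.
Qed.

(** Triangle inequality along the edges from [i] to [j]. The map [f] stands for either coordinate;
    the bound confines a normalized polygon to a box. *)
Lemma norm_vertex_le_perimeter (R : realType) (n : nat) (P : 'I_n -> R * R)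
    (f : R * R -> R) (i j : 'I_n) :
  {morph f : x y / x - y} -> (forall u, `|f u| <= enorm u) ->
  (i <= j)%N -> `|f (P j) - f (P i)| <= perimeter P.
Proof.
move=> fB fle leij.
suff H k : (i <= k < n)%N -> forall l : 'I_n, l = k :> nat ->
    `|f (P l) - f (P i)| <= \sum_(m < n | (m < k)%N) edge_length P m.
  apply: le_trans (H j _ j erefl) _; first by rewrite leij /=.
  rewrite /perimeter [leRHS](bigID (fun m : 'I_n => (m < j)%N)) /= lerDl.
  by apply: sumr_ge0 => m _; exact: edge_length_ge0.
elim: k => [|k IH] /andP[ik kn] l lk.
  have -> : l = i by apply/val_inj; rewrite /= lk; case: (val i) ik.
  by rewrite subrr normr0 sumr_ge0 // => m _; exact: edge_length_ge0.
move: ik; rewrite leq_eqVlt => /orP[/eqP ik|ik].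
  have -> : l = i by apply/val_inj; rewrite /= lk.
  by rewrite subrr normr0 sumr_ge0 // => m _; exact: edge_length_ge0.
have kn' : (k < n)%N by apply: ltn_trans kn.
have lS : l = ordS (Ordinal kn').
  by apply/val_inj; rewrite /= modn_small.
rewrite (bigD1 (Ordinal kn')) //= -(subrKA (f (P (Ordinal kn')))).
apply: le_trans (ler_normD _ _) _; apply: lerD.
  by rewrite -fB lS; exact: fle.
apply: le_trans (IH _ (Ordinal kn') erefl) _; first by rewrite kn' andbT.
rewrite le_eqVlt; apply/orP; left; apply/eqP/eq_bigl => m /=.
rewrite -val_eqE /= ltnS [in RHS]leq_eqVlt.
by case: ltngtP.
Qed.

Lemma continuous_area (R : realType) (T : topologicalType) (n : nat)
    (P : T -> 'I_n -> R * R) :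
  (forall i, continuous (fun v => (P v i).1)) ->
  (forall i, continuous (fun v => (P v i).2)) ->
  continuous (fun v => area (P v)).
Proof.
move=> c1 c2 v; apply: cvgMr; apply: cvg_big => [|i _]; first exact: add_continuous.
rewrite /cross; apply: cvgB; apply: cvgM; by [apply: c1 | apply: c2].
Qed.

Lemma continuous_perimeter (R : realType) (T : topologicalType) (n : nat)
    (P : T -> 'I_n -> R * R) :
  (forall i, continuous (fun v => (P v i).1)) ->
  (forall i, continuous (fun v => (P v i).2)) ->
  continuous (fun v => perimeter (P v)).
Proof.
move=> c1 c2 v; apply: cvg_big => [|i _]; first exact: add_continuous.
rewrite /edge_length /enorm.
apply: (@continuous_comp _ _ _ (fun v => _) (@Num.sqrt R)); last exact: sqrt_continuous.
by apply: cvgD; apply: cvgM; apply: cvgB; (exact: c1 || exact: c2).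
Qed.

(** Area over squared perimeter is invariant under homothety, so it suffices to maximize the area
    over polygons with coordinates in [-1, 1] and perimeter at most 1. Admitting all closed polygons
    makes this set compact; coordinates are packed into one row vector to use the compactness of
    boxes. *)
Lemma exists_isoperimetric_constant (R : realType) (n : nat) : (0 < n)%N ->
  exists2 P : 'I_n -> R * R, perimeter P <= 1 &
    forall Q : 'I_n -> R * R, area Q <= area P * perimeter Q ^+ 2.
Proof.
move=> n0.
pose poly (v : 'rV[R]_(n + n)) (i : 'I_n) := (v ord0 (lshift n i), v ord0 (rshift n i)).
pose row (P : 'I_n -> R * R) : 'rV[R]_(n + n) :=
  row_mx (\row_i (P i).1) (\row_i (P i).2).
have rowK P : poly (row P) =1 P.
  move=> i; rewrite /poly /row row_mxEl row_mxEr !mxE; exact/esym/surjective_pairing.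
have c1 i : continuous (fun v => (poly v i).1) by exact: coord_continuous.
have c2 i : continuous (fun v => (poly v i).2) by exact: coord_continuous.
pose box := [set v : 'rV[R]_(n + n) | forall i, `[(- 1), 1]%classic (v ord0 i)].
pose K := box `&` [set v | perimeter (poly v) <= 1].
have cK : compact K.
  apply: compact_closedI.
    apply: (@rV_compact R (n + n) (fun=> `[(- 1), 1]%classic)).
    by move=> _; apply: segment_compact.
  apply: (@closed_comp _ _ (fun v => perimeter (poly v)) [set x | x <= 1]).
    by move=> v _; exact: continuous_perimeter.
  exact: closed_le.
have K0 : K !=set0.
  exists 0; split=> [i|]; first by rewrite /= mxE in_itv /= lerN10 ler01.
  rewrite /= /perimeter big1 // => i _.
  by rewrite /edge_length /enorm /poly /= !mxE subrr expr0n addr0 sqrtr0.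
have [v] := EVT_max_rV K0 cK (continuous_subspaceT (continuous_area c1 c2)).
rewrite inE => -[_ /= v1] vmax.
exists (poly v) => // Q.
(* A polygon of perimeter 0 cannot be normalized, but all its vertices coincide and its area is
   0. *)
have [L0|L0] := eqVneq (perimeter Q) 0.
  have E i : edge_length Q i = 0.
    apply/eqP; move/eqP: L0; rewrite psumr_eq0; last by move=> *; exact: edge_length_ge0.
    by move/allP/(_ i); rewrite mem_index_enum => /(_ isT).
  rewrite L0 expr0n /= mulr0 /area big1 ?mulr0 // => i _.
  move/enorm_eq0: (E i) => /eqP; rewrite subr_eq0 => /eqP ->.
  by rewrite /cross; ring.
have Lp : 0 < perimeter Q by rewrite lt_neqAle eq_sym L0 perimeter_ge0.
pose i0 := Ordinal n0.
(* Vertex 0 at the origin and perimeter 1: all coordinates then lie in [-1, 1]. *)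
pose Q' := homothety (perimeter Q)^-1 (Q i0) Q.
have Ki : K (row Q').
  have eQ : poly (row Q') = Q' by apply/funext/rowK.
  split; last by rewrite /= eQ perimeter_homothety ?invr_ge0 ?perimeter_ge0 // mulVf.
  have key f i : {morph f : x y / x - y} -> (forall u : R * R, `|f u| <= enorm u) ->
      (perimeter Q)^-1 * (f (Q i) - f (Q i0)) \in `[(-1), 1].
    move=> fB fle; rewrite in_itv /= -ler_norml normrM gtr0_norm ?invr_gt0 //.
    by rewrite mulrC ler_pdivrMr // mul1r; apply: norm_vertex_le_perimeter.
  move=> i /=; rewrite -(splitK i); case: (fintype.split i) => j /=.
    have := rowK Q' j => /(congr1 fst) /= ->.
    by apply: (key fst) => //; exact: norm_fst_le_enorm.
  have := rowK Q' j => /(congr1 snd) /= ->.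
  by apply: (key snd) => //; exact: norm_snd_le_enorm.
have := vmax (row Q'); rewrite inE => /(_ Ki) /=.
rewrite (_ : poly (row Q') = Q'); last by apply/funext/rowK.
by rewrite area_homothety exprVn mulrC ler_pdivrMr // exprn_gt0.
Qed.

(** * Equal edges of an optimal polygon *)

Lemma ordS_neq (n : nat) (i : 'I_n) : (1 < n)%N -> ordS i != i.
Proof.
move=> n1; rewrite -val_eqE /=; have := ltn_ord i.
rewrite leq_eqVlt => /orP[/eqP e|lt]; last by rewrite modn_small // gtn_eqF.
by rewrite e modnn; apply: contraTneq n1 => i0; rewrite -e -i0.
Qed.

Lemma ord_ind_cyclic (n : nat) (Q : 'I_n -> Prop) (i0 : 'I_n) :
  i0 = 0%N :> nat -> Q i0 -> (forall i, Q i -> Q (ordS i)) -> forall i, Q i.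
Proof.
move=> i00 Q0 QS [k kn]; elim: k kn => [|k IH] kn.
  by rewrite (_ : Ordinal kn = i0) //; exact/val_inj.
have kn' := ltnW kn.
rewrite (_ : Ordinal kn = ordS (Ordinal kn')); first exact/QS/IH.
by apply/val_inj; rewrite /= modn_small.
Qed.

(** Only the two edges at [i] change. An abstract [F] serves the area and the perimeter alike. *)
Lemma sum_update (R : realType) (n : nat) (P : 'I_n -> R * R) (i : 'I_n)
    (q : R * R) (F : R * R -> R * R -> R) : (1 < n)%N ->
  let P' j := if j == i then q else P j in
  \sum_(j < n) F (P' j) (P' (ordS j)) =
  \sum_(j < n) F (P j) (P (ordS j))
  - F (P (ord_pred i)) (P i) - F (P i) (P (ordS i))
  + F (P (ord_pred i)) q + F q (P (ordS i)).
Proof.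
move=> n1 P'.
have pi : ord_pred i != i.
  by rewrite -(inj_eq (@ordS_inj n)) ord_predK eq_sym ordS_neq.
have e : \sum_(j < n | (j != i) && (j != ord_pred i)) F (P' j) (P' (ordS j)) =
    \sum_(j < n | (j != i) && (j != ord_pred i)) F (P j) (P (ordS j)).
  apply: eq_bigr => j /andP[ji jp]; rewrite /P' (negbTE ji) ifN //.
  by apply: contraNneq jp => <-; rewrite ordSK.
rewrite [LHS](bigD1 i) //= [in LHS](bigD1 (ord_pred i)) //= e.
rewrite [X in _ = X - _ - _ + _ + _](bigD1 i) //= [in RHS](bigD1 (ord_pred i)) //=.
rewrite /P' eqxx ord_predK eqxx (negbTE pi) (negbTE (ordS_neq i n1)).
by ring.
Qed.

Lemma dot_le_enorm (R : realType) (u v : R * R) : dot u v <= enorm u * enorm v.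
Proof.
apply: le_trans (ler_norm _) _.
rewrite -(@ler_pXn2r _ 2) ?nnegrE ?mulr_ge0 ?enorm_ge0 //.
rewrite real_normK ?num_real // exprMn !sqr_enorm -subr_ge0.
by rewrite (_ : _ - _ = cross u v ^+ 2) ?sqr_ge0 // /cross /dot; ring.
Qed.

Lemma sqr_dotDcross (R : realType) (u v : R * R) :
  dot u v ^+ 2 + cross u v ^+ 2 = (enorm u * enorm v) ^+ 2.
Proof. by rewrite exprMn !sqr_enorm /dot /cross; ring. Qed.

(* The vertex [i] is moved to the apex of an isosceles triangle whose base is
   the diagonal joining the two neighbours of [i] and whose height is [kappa]
   times that base. *)
Lemma isosceles_variation (R : realType) (n : nat) (P : 'I_n -> R * R)
    (i : 'I_n) (M kappa : R) (u v : R * R) : (1 < n)%N ->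
  (forall Q : 'I_n -> R * R, area Q <= M * perimeter Q ^+ 2) ->
  u = P i - P (ord_pred i) -> v = P (ordS i) - P i ->
  area P + 2^-1 * (kappa * enorm (u + v) ^+ 2 - cross u v) <=
  M * (perimeter P - enorm u - enorm v
       + enorm (u + v) * Num.sqrt (1 + 4 * kappa ^+ 2)) ^+ 2.
Proof.
move=> n1 HM eu ev; set d := u + v.
pose p := P (ord_pred i); pose s := P (ordS i).
(* Midpoint of the base plus [kappa] times [d] turned clockwise: the triangle [p], [q], [s] has
   signed area [kappa * enorm d ^+ 2 / 2]. *)
pose q : R * R := ((p.1 + s.1) / 2 + kappa * d.2, (p.2 + s.2) / 2 - kappa * d.1).
have d1 : d.1 = s.1 - p.1 by rewrite /d eu ev /p /s /=; ring.
have d2 : d.2 = s.2 - p.2 by rewrite /d eu ev /p /s /=; ring.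
clearbody d.
have hs x y : x ^+ 2 + y ^+ 2 = (d.1 ^+ 2 + d.2 ^+ 2) * (1 + 4 * kappa ^+ 2) / 4 ->
    enorm (x, y) = 2^-1 * (enorm d * Num.sqrt (1 + 4 * kappa ^+ 2)).
  move=> e.
  have K0 : 0 <= 1 + 4 * kappa ^+ 2 by have := sqr_ge0 kappa; lra.
  have D0 : 0 <= d.1 ^+ 2 + d.2 ^+ 2 by rewrite addr_ge0 // sqr_ge0.
  rewrite {1}/enorm e sqrtrM ?sqrtrM //; last exact: mulr_ge0.
  rewrite mulrC; congr (_ * _).
  rewrite (_ : 4^-1 = (2^-1) ^+ 2); last by field.
  by rewrite sqrtr_sqr ger0_norm // invr_ge0.
have e1 : enorm (q - p) = 2^-1 * (enorm d * Num.sqrt (1 + 4 * kappa ^+ 2)).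
  by rewrite (surjective_pairing (q - p)); apply: hs; rewrite /= d1 d2; field.
have e2 : enorm (s - q) = 2^-1 * (enorm d * Num.sqrt (1 + 4 * kappa ^+ 2)).
  by rewrite (surjective_pairing (s - q)); apply: hs; rewrite /= d1 d2; field.
have := HM (fun j => if j == i then q else P j).
rewrite /area (sum_update P i q (@cross R) n1) /perimeter /edge_length.
rewrite (sum_update P i q (fun x y => enorm (y - x)) n1) -/p -/s e1 e2.
move=> H; rewrite -eu -ev in H *; apply: le_trans (le_trans H _); last first.
  rewrite le_eqVlt; apply/orP; left; apply/eqP; congr (_ * _ ^+ 2).
  by rewrite /area; field.
rewrite le_eqVlt; apply/orP; left; apply/eqP.
rewrite /cross sqr_enorm d1 d2 eu ev /= -/p -/s !(d1, d2).
set S := \sum_(j < n) _.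
by field.
Qed.

(** If the two edges at a vertex have lengths [a != b], an isosceles triangle on the same diagonal
    contradicts optimality: one with the same sum [a + b] when [y < a * b], one of small height when
    the triangle is flat. *)
Lemma optimal_edges_eq (R : realType) (n : nat) (P : 'I_n -> R * R) (M : R) :
  (1 < n)%N -> 0 < M ->
  (forall Q : 'I_n -> R * R, area Q <= M * perimeter Q ^+ 2) ->
  area P = M * perimeter P ^+ 2 ->
  forall i, edge_length P (ordS i) = edge_length P i.
Proof.
move=> n1 M0 HM eP i0.
rewrite /edge_length; set i := ordS i0.
have ip : i0 = ord_pred i by rewrite ordSK.
rewrite {1}ip; set u := P i - P (ord_pred i); set v := P (ordS i) - P i.
have var kappa := @isosceles_variation R n P i M kappa u v n1 HM erefl erefl.
have := dot_le_enorm u v; have := sqr_dotDcross u v.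
have := enorm_ge0 u; have := enorm_ge0 v; have := enorm_ge0 (u + v).
have : enorm (u + v) ^+ 2 = enorm u ^+ 2 + enorm v ^+ 2 + 2 * dot u v.
  by rewrite !sqr_enorm /dot /=; ring.
have := perimeter_ge0 P.
move: var eP; clearbody u v.
set L := perimeter P; set A := area P; set a := enorm u; set b := enorm v.
set c := enorm (u + v); set x := cross u v; set y := dot u v.
clearbody L A a b c x y => var eP L0 c2 c0 b0 a0 xy yab.
apply/eqP/negP => /negP ab.
have ab2 : 0 < (a - b) ^+ 2.
  by rewrite lt_neqAle sqr_ge0 andbT eq_sym sqrf_eq0 subr_eq0 eq_sym.
(* The base is nonzero because c^2 = (a - b)^2 + 2 (a b + y) and -y <= a b. *)
have cpos : 0 < c.
  rewrite lt_neqAle c0 andbT; apply: contraTneq ab2 => c00.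
  have yab' : - y <= a * b.
    rewrite leNgt; apply/negP => H; have ab0 := mulr_ge0 a0 b0.
    by have := sqr_ge0 x; nra.
  by rewrite -leNgt; nra.
move: yab; rewrite le_eqVlt => /orP[/eqP yab|yab].
- (* Degenerate triangle: a small height costs only second order in length. *)
  have x0 : x = 0.
    apply/eqP; rewrite -sqrf_eq0; apply/eqP; move: xy; rewrite yab; lra.
  have cab : c = a + b.
    apply/eqP; rewrite -(@eqrXn2 _ 2) ?addr_ge0 //; apply/eqP; rewrite c2 yab; ring.
  (* Chosen so that [k <= 1] and [4 * M * (L + c) * k < c / 2]. The area gain k c^2 / 2 then exceeds
     the growth 4 M L c k^2 + 4 M c^2 k^4 of the bound. *)
  pose k := c / (c + 16 * M * (L + c)).
  have D0 : 0 < c + 16 * M * (L + c) by nra.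
  have k0 : 0 < k by rewrite divr_gt0.
  have k1 : k <= 1 by rewrite ler_pdivrMr // mul1r; nra.
  have kD : k * (c + 16 * M * (L + c)) = c by rewrite /k mulfVK // gt_eqF.
  have sq : Num.sqrt (1 + 4 * k ^+ 2) <= 1 + 2 * k ^+ 2.
    rewrite -(@ler_pXn2r _ 2) ?nnegrE ?sqrtr_ge0 //; last by nra.
    by rewrite sqr_sqrtr; nra.
  have sq1 : 1 <= Num.sqrt (1 + 4 * k ^+ 2).
    by rewrite -[leLHS]sqrtr1 ler_wsqrtr // lerDl; nra.
  have := var k; rewrite x0 subr0 eP.
  set S := Num.sqrt _ in sq sq1 *.
  rewrite (_ : L - a - b + c * S = L + c * (S - 1)); last by rewrite cab; ring.
  apply/negP; rewrite -ltNge.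
  have le1 : L + c * (S - 1) <= L + 2 * c * k ^+ 2 by nra.
  have ge1 : 0 <= L + c * (S - 1) by nra.
  have le2 : (L + c * (S - 1)) ^+ 2 <= (L + 2 * c * k ^+ 2) ^+ 2.
    by rewrite ler_pXn2r ?nnegrE //; exact: le_trans le1.
  have le3 : M * (L + c * (S - 1)) ^+ 2 <= M * (L + 2 * c * k ^+ 2) ^+ 2.
    by rewrite ler_pM2l.
  apply: le_lt_trans le3 _.
  have : 4 * M * (L + c) * k < c / 2 by nra.
  move=> small.
  rewrite -subr_gt0.
  rewrite (_ : _ - _ =
    c * k * (c / 2 - 4 * M * L * k - 4 * M * c * k ^+ 3)); last by ring.
  apply: mulr_gt0; first exact: mulr_gt0.
  have : k ^+ 3 <= k by rewrite -[leRHS]expr1 ler_wiXn2l // ltW.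
  move=> k3.
  have : M * c * k ^+ 3 <= M * c * k by rewrite ler_pM2l // mulr_gt0.
  nra.
(* Height of the isosceles triangle with base [c] and legs (a + b) / 2, since ((a + b)^2 - c^2) / 4
   = (a b - y) / 2. The perimeter is unchanged, so a contradiction follows once the area strictly
   grows, that is [x < h * c]. *)
pose h := Num.sqrt ((a * b - y) / 2).
have h2 : h ^+ 2 = (a * b - y) / 2 by rewrite sqr_sqrtr //; lra.
have h0 : 0 <= h by exact: sqrtr_ge0.
pose k := h / c.
have kc : k * c = h by rewrite /k mulfVK // gt_eqF.
have cS : c * Num.sqrt (1 + 4 * k ^+ 2) = a + b.
  rewrite -{1}(gtr0_norm cpos) -sqrtr_sqr -sqrtrM ?sqr_ge0 //.
  rewrite (_ : _ * _ = (a + b) ^+ 2).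
    by rewrite sqrtr_sqr ger0_norm // addr_ge0.
  rewrite mulrDr mulr1 mulrCA -exprMn [c * k]mulrC kc h2 c2.
  by field.
have := var k; rewrite eP cS (_ : L - a - b + (a + b) = L); last by ring.
apply/negP; rewrite -ltNge ltrDl mulr_gt0 // subr_gt0.
apply: le_lt_trans (ler_norm _) _.
rewrite (_ : k * c ^+ 2 = h * c); last by rewrite -kc; ring.
rewrite -(@ltr_pXn2r _ 2) ?nnegrE ?mulr_ge0 // real_normK ?num_real //.
rewrite exprMn h2 c2 -subr_gt0.
rewrite (_ : _ - _ = (a * b - y) * (a - b) ^+ 2 / 2).
  by rewrite divr_gt0 // mulr_gt0 // subr_gt0.
have -> : x ^+ 2 = (a * b) ^+ 2 - y ^+ 2 by rewrite -xy; ring.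
by field.
Qed.

(** * The discrete Fourier transform *)

Definition cis (R : realType) (x : R) : R[i] := (cos x +i* sin x)%C.

Lemma cisD (R : realType) (x y : R) : cis (x + y) = cis x * cis y.
Proof.
apply/eqP; rewrite eq_complex /= cosD sinD; apply/andP; split; apply/eqP; ring.
Qed.

Lemma cis0 (R : realType) : cis (0 : R) = 1.
Proof. by rewrite /cis cos0 sin0. Qed.

Lemma cisX (R : realType) (x : R) k : cis x ^+ k = cis (k%:R * x).
Proof.
elim: k => [|k IH]; first by rewrite mul0r cis0 expr0.
by rewrite exprS IH -cisD -natr1; congr cis; ring.
Qed.

Lemma cis_conj (R : realType) (x : R) : conjc (cis x) * cis x = 1.
Proof.
apply/eqP; rewrite eq_complex /=; apply/andP; split; apply/eqP; last by ring.
by rewrite -(cos2Dsin2 x); ring.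
Qed.

Definition unity_root (R : realType) n : R[i] := cis (2 * (pi / n%:R)).

Lemma sin_unity_gt0 (R : realType) n k : (0 < k < n)%N ->
  0 < sin (k%:R * (pi / n%:R) : R).
Proof.
move=> /andP[k0 kn]; have n0 : (0 : R) < n%:R by rewrite ltr0n (leq_trans _ kn).
apply: sin_gt0_pi; rewrite mulr_gt0 ?divr_gt0 ?ltr0n ?pi_gt0 //=.
  by rewrite mulrCA gtr_pMr ?pi_gt0 // ltr_pdivrMr // mul1r ltr_nat.
by rewrite -(ltr_nat R).
Qed.

(** For 0 < k < n the real part of w^k is 1 - 2 sin^2(k pi/n) < 1. *)
Lemma unity_root_prim (R : realType) n : (0 < n)%N ->
  n.-primitive_root (unity_root R n).
Proof.
move=> n0; have nn : (n%:R : R) != 0 by rewrite pnatr_eq0 -lt0n.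
apply/andP; split=> //; apply/forallP => i; rewrite unity_rootE.
rewrite /unity_root cisX.
have [->|ni] := eqVneq i.+1 n.
  rewrite (_ : _ * _ = pi *+ 2); last by rewrite mulr2n; field.
  by rewrite /cis cos2pi sin2pi eqxx.
apply/eqP/negbTE; rewrite eq_complex /= negb_and; apply/orP; left.
have lt : (0 < i.+1 < n)%N by rewrite /= ltn_neqAle ni ltn_ord.
have := sin_unity_gt0 R lt; set x := _ * (pi / _) => sx.
rewrite (_ : _ * _ = x *+ 2); last by rewrite /x mulr2n; ring.
by rewrite cos_mulr2n cos2sin2; apply/eqP; nra.
Qed.

Section DFT.
Variables (R : realType) (n : nat) (w : R[i]).
Hypotheses (wp : n.-primitive_root w) (wJ : conjc w * w = 1).

Definition dft (z : 'I_n -> R[i]) (k : 'I_n) : R[i] :=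
  \sum_(j < n) z j * conjc w ^+ (j * k).

(** A geometric sum of ratio r = w^(l - j), which satisfies r^n = 1 and equals 1 only for j = l. *)
Lemma dft_orthogonality (j l : 'I_n) :
  \sum_(k < n) conjc w ^+ (j * k) * w ^+ (l * k) = n%:R * (j == l)%:R.
Proof.
under eq_bigr do rewrite !exprM -exprMn.
set r := _ * _; have rn : r ^+ n = 1.
  rewrite /r exprMn -!exprM ![(_ * n)%N]mulnC !exprM -rmorphXn /=.
  by rewrite (prim_expr_order wp) rmorph1 !expr1n mulr1.
have rE : (r == 1) = (j == l).
  have wj0 : w ^+ j != 0.
    by rewrite expf_neq0 //; apply: contraTneq isT => w0; move/eqP: wJ;
       rewrite w0 mulr0 eq_sym oner_eq0.
  have rj : r * w ^+ j = w ^+ l.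
    by rewrite /r mulrAC -exprMn wJ expr1n mul1r.
  rewrite -(inj_eq (mulIf wj0)) rj mul1r (eq_prim_root_expr wp).
  by rewrite !modn_small // eq_sym.
have [e|ne] := eqVneq j l.
  have /eqP -> : r == 1 by rewrite rE e.
  by under eq_bigr do rewrite expr1n; rewrite sumr_const card_ord mulr1.
rewrite mulr0; apply: (@mulfI _ (r - 1)); first by rewrite subr_eq0 rE.
by rewrite -subrX1 rn subrr mulr0.
Qed.

Lemma dft_inverse (z : 'I_n -> R[i]) (j : 'I_n) :
  \sum_(k < n) dft z k * w ^+ (j * k) = n%:R * z j.
Proof.
rewrite /dft; under eq_bigr do rewrite mulr_suml.
rewrite exchange_big /=.
under eq_bigr => i _ do (under eq_bigr do rewrite -mulrA;
  rewrite -mulr_sumr dft_orthogonality).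
rewrite (bigD1 j) //= eqxx mulr1 mulrC big1 ?addr0 // => i /negbTE ->.
by rewrite !mulr0.
Qed.

(** Stated for two sequences because it is also applied to a polygon and its cyclic shift, where the
    products carry [dot] and [cross] of consecutive vertices. *)
Lemma dft_parseval (z z' : 'I_n -> R[i]) :
  \sum_(k < n) dft z k * conjc (dft z' k) =
  n%:R * \sum_(j < n) z j * conjc (z' j).
Proof.
transitivity (\sum_(k < n) \sum_(l < n) conjc (z' l) * (dft z k * w ^+ (l * k))).
  apply: eq_bigr => k _; rewrite {2}/dft rmorph_sum mulr_sumr /=.
  apply: eq_bigr => l _; rewrite rmorphM rmorphXn /= conjcK; ring.
rewrite exchange_big mulr_sumr /=; apply: eq_bigr => l _.
by rewrite -mulr_sumr dft_inverse; ring.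
Qed.

Lemma dft_ordS (z : 'I_n -> R[i]) (k : 'I_n) :
  dft (fun j => z (ordS j)) k = w ^+ k * dft z k.
Proof.
rewrite /dft mulr_sumr -[RHS]sum_ordS; apply: eq_bigr => j _.
(* [ordS] reduces the index modulo [n], which is harmless since w^n = 1. *)
have -> : conjc w ^+ (ordS j * k) = conjc w ^+ (j * k) * conjc w ^+ k.
  have wX m : conjc w ^+ m = conjc (w ^+ m) by rewrite rmorphXn.
  rewrite !wX -rmorphM /=; congr conjc.
  rewrite exprM (prim_expr_mod wp) -exprM -exprD; congr (_ ^+ _).
  by rewrite mulSn addnC.
have : conjc w ^+ k * w ^+ k = 1 by rewrite -exprMn wJ expr1n.
move=> e; transitivity (z (ordS j) * conjc w ^+ (j * k) * (conjc w ^+ k * w ^+ k)).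
  by rewrite e mulr1.
by ring.
Qed.

End DFT.

(** * Fourier expansion of area and edge lengths *)

Definition toC (R : realType) (u : R * R) : R[i] := (u.1 +i* u.2)%C.

Lemma Re_sum (R : rcfType) (I : Type) (r : seq I) (Q : pred I) (F : I -> R[i]) :
  Re (\sum_(i <- r | Q i) F i) = \sum_(i <- r | Q i) Re (F i).
Proof. by apply: big_morph => // -[? ?] [? ?]. Qed.

Lemma Im_sum (R : rcfType) (I : Type) (r : seq I) (Q : pred I) (F : I -> R[i]) :
  Im (\sum_(i <- r | Q i) F i) = \sum_(i <- r | Q i) Im (F i).
Proof. by apply: big_morph => // -[? ?] [? ?]. Qed.

Lemma Re_real_complexM (R : rcfType) (x : R) (z : R[i]) : Re (x%:C%C * z) = x * Re z.
Proof. by case: z => a b /=; rewrite mul0r subr0. Qed.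

Lemma Im_real_complexM (R : rcfType) (x : R) (z : R[i]) : Im (x%:C%C * z) = x * Im z.
Proof. by case: z => a b /=; rewrite mul0r addr0. Qed.

(** Parseval diagonalizes the sums of squared norms ([S0]), of consecutive dot products ([S1]) and
    of consecutive cross products ([S2]); edge lengths and area are combinations of these. *)
Lemma wirtinger_identity (R : realType) (n : nat) (P : 'I_n -> R * R) :
  (0 < n)%N ->
  let t : R := pi / n%:R in
  let h := dft (unity_root R n) (fun j => toC (P j)) in
  n%:R * (cos t * \sum_(i < n) edge_length P i ^+ 2 - 4 * sin t * area P) =
  \sum_(k < n) 4 * sin (k%:R * t) * sin ((k%:R - 1) * t) *
    (Re (h k) ^+ 2 + Im (h k) ^+ 2).
Proof.
move=> n0 t h; set w := unity_root R n; set z := fun j => toC (P j).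
have wp : n.-primitive_root w := unity_root_prim R n0.
have wJ : conjc w * w = 1 := cis_conj _.
pose H k := Re (h k) ^+ 2 + Im (h k) ^+ 2.
have wX k : w ^+ k = cis (k%:R * (2 * t)) by rewrite /w /unity_root cisX.
have nn : n%:R = (n%:R : R)%:C%C by rewrite -[RHS]/(real_complex R _) rmorph_nat.
have E0 := dft_parseval wp wJ z z; have E1 := dft_parseval wp wJ (fun j => z (ordS j)) z.
have S0 : \sum_(k < n) H k = n%:R * \sum_(j < n) dot (P j) (P j).
  move/(congr1 (@Re R)): E0; rewrite nn Re_real_complexM !Re_sum.
  set X := \sum_(k < n) _ => e; rewrite (_ : \sum_(k < n) _ = X).
    by rewrite e; congr (_ * _); apply: eq_bigr => k _; rewrite /dot /=; ring.
  by apply: eq_bigr => k _; rewrite /H -/h; case: (h k) => x y /=; ring.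
have S1 : \sum_(k < n) cos (k%:R * (2 * t)) * H k =
    n%:R * \sum_(j < n) dot (P j) (P (ordS j)).
  move/(congr1 (@Re R)): E1; rewrite nn Re_real_complexM !Re_sum.
  under eq_bigr do rewrite (dft_ordS wp wJ) wX -/h.
  set X := \sum_(k < n) _ => e; rewrite (_ : \sum_(k < n) _ = X).
    by rewrite e; congr (_ * _); apply: eq_bigr => k _; rewrite /dot /=; ring.
  by apply: eq_bigr => k _; rewrite /H; case: (h k) => x y /=; ring.
have S2 : \sum_(k < n) sin (k%:R * (2 * t)) * H k =
    n%:R * \sum_(j < n) cross (P j) (P (ordS j)).
  move/(congr1 (@Im R)): E1; rewrite nn Im_real_complexM !Im_sum.
  under eq_bigr do rewrite (dft_ordS wp wJ) wX -/h.
  set X := \sum_(k < n) _ => e; rewrite (_ : \sum_(k < n) _ = X).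
    by rewrite e; congr (_ * _); apply: eq_bigr => k _; rewrite /cross /=; ring.
  by apply: eq_bigr => k _; rewrite /H; case: (h k) => x y /=; ring.
have S3 : \sum_(i < n) edge_length P i ^+ 2 =
    2 * (\sum_(j < n) dot (P j) (P j)) - 2 * \sum_(j < n) dot (P j) (P (ordS j)).
  rewrite mulr2n mulrDl mul1r -{1}(sum_ordS (fun j => dot (P j) (P j))).
  rewrite mulr_sumr -big_split -sumrB /=.
  by apply: eq_bigr => j _; rewrite sqr_enorm /dot /=; ring.
rewrite /area S3 (_ : _ * _ = cos t * (2 * (\sum_(k < n) H k)
   - 2 * (\sum_(k < n) cos (k%:R * (2 * t)) * H k))
   - 2 * sin t * \sum_(k < n) sin (k%:R * (2 * t)) * H k); last first.
  by rewrite S0 S1 S2; field.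
rewrite !mulr_sumr -sumrB mulr_sumr -sumrB; apply: eq_bigr => k _.
rewrite -/(H k) (_ : k%:R * (2 * t) = (k%:R * t) *+ 2); last by rewrite mulr2n; ring.
rewrite (_ : (k%:R - 1) * t = k%:R * t - t); last by ring.
(* With x = k t: 2 cos t (1 - cos 2x) - 2 sin t sin 2x = 4 sin x sin(x - t). *)
rewrite sinB cos_mulr2n sin_mulr2n cos2sin2; ring.
Qed.

(** * Wirtinger and isoperimetric inequalities *)

Lemma wirtinger_coef_ge0 (R : realType) n k : (k < n)%N ->
  0 <= sin (k%:R * (pi / n%:R)) * sin ((k%:R - 1) * (pi / n%:R)) :> R.
Proof.
case: k => [|[|k]] kn; first by rewrite mul0r sin0 mul0r.
  by rewrite subrr mul0r sin0 mulr0.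
rewrite -[X in X - 1]natr1 addrK ltW // mulr_gt0 // sin_unity_gt0 //=.
exact: ltnW.
Qed.

Lemma wirtinger_coef_gt0 (R : realType) n k : (1 < k < n)%N ->
  0 < sin (k%:R * (pi / n%:R)) * sin ((k%:R - 1) * (pi / n%:R)) :> R.
Proof.
case: k => [|[|k]] //= kn.
by rewrite -[X in X - 1]natr1 addrK mulr_gt0 // sin_unity_gt0 //= ltnW.
Qed.

Lemma wirtinger (R : realType) (n : nat) (P : 'I_n -> R * R) : (0 < n)%N ->
  4 * sin (pi / n%:R) * area P <=
  cos (pi / n%:R) * \sum_(i < n) edge_length P i ^+ 2.
Proof.
move=> n0; rewrite -subr_ge0 -(@pmulr_rge0 _ n%:R) ?ltr0n //.
rewrite wirtinger_identity //; apply: sumr_ge0 => k _.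
apply: mulr_ge0; last by rewrite addr_ge0 ?sqr_ge0.
rewrite -mulrA mulr_ge0 //.
exact: wirtinger_coef_ge0.
Qed.

(** A vanishing sum of nonnegative terms kills every frequency above 1; Fourier inversion leaves the
    constant term and the first harmonic. *)
Lemma wirtinger_eq (R : realType) (n : nat) (P : 'I_n -> R * R) : (1 < n)%N ->
  4 * sin (pi / n%:R) * area P =
  cos (pi / n%:R) * \sum_(i < n) edge_length P i ^+ 2 ->
  exists c a : R[i], forall j, toC (P j) = c + a * unity_root R n ^+ j.
Proof.
move=> n1 eP; have n0 := ltnW n1.
have /esym/eqP := wirtinger_identity P n0; rewrite eP subrr mulr0.
rewrite psumr_eq0; last first.
  move=> k _; apply: mulr_ge0; last by rewrite addr_ge0 ?sqr_ge0.
  rewrite -mulrA mulr_ge0 //.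
  exact: wirtinger_coef_ge0.
set h := dft _ _; move=> /allP h0.
have hk (k : 'I_n) : (1 < k)%N -> h k = 0.
  move=> k1; have := h0 k; rewrite mem_index_enum => /(_ isT) /=.
  have cp : 0 < sin (k%:R * (pi / n%:R)) * sin ((k%:R - 1) * (pi / n%:R)) :> R.
    by apply: wirtinger_coef_gt0; rewrite k1 ltn_ord.
  rewrite -[4 * _ * _]mulrA mulf_eq0 gt_eqF /=; last exact: mulr_gt0.
  rewrite paddr_eq0 ?sqr_ge0 // !sqrf_eq0 => /andP[/eqP x /eqP y].
  by apply/eqP; rewrite eq_complex x y eqxx.
have nn : (n%:R : R[i]) != 0 by rewrite pnatr_eq0 -lt0n.
exists (h (Ordinal n0) / n%:R), (h (Ordinal n1) / n%:R) => j.
apply: (mulfI nn).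
rewrite -(dft_inverse (unity_root_prim R n0) (cis_conj _) (fun j => toC (P j))) -/h.
rewrite (bigD1 (Ordinal n0)) //= (bigD1 (Ordinal n1)) //= big1 ?addr0 => [|k].
  rewrite muln0 muln1 expr0 mulr1 mulrDr; congr (_ + _); first by field.
  by rewrite mulrA; congr (_ * _); field.
rewrite -!val_eqE /= => /andP[k0 k1]; rewrite hk ?mul0r //.
by case: (val k) k0 k1 => [|[]].
Qed.

Lemma sin_pi_div_gt0 (R : realType) n : (2 < n)%N -> 0 < sin (pi / n%:R : R).
Proof.
by move=> n2; have := @sin_unity_gt0 R n 1 (ltnW n2); rewrite mul1r.
Qed.

Lemma cos_pi_div_gt0 (R : realType) n : (2 < n)%N -> 0 < cos (pi / n%:R : R).
Proof.
move=> n2; have n0 : (0 : R) < n%:R by rewrite ltr0n (leq_trans _ n2).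
apply: cos_gt0_pihalf; apply/andP; split.
  by rewrite (@lt_trans _ _ 0) ?oppr_lt0 ?divr_gt0 ?pi_gt0.
by rewrite ltr_pM2l ?pi_gt0 // ltf_pV2 ?posrE // ltr_nat.
Qed.

Lemma equilateral_sum_sqr (R : realType) (n : nat) (P : 'I_n -> R * R) :
  (forall i, edge_length P (ordS i) = edge_length P i) ->
  n%:R * \sum_(i < n) edge_length P i ^+ 2 = perimeter P ^+ 2.
Proof.
case: n P => [|n] P eP; first by rewrite /perimeter !big_ord0 mulr0 expr0n.
have E i : edge_length P i = edge_length P ord0.
  by move: i; apply: (@ord_ind_cyclic _ _ ord0) => // i <-.
rewrite /perimeter; under eq_bigr do rewrite E.
under [in RHS]eq_bigr do rewrite E.
rewrite !sumr_const card_ord.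
by rewrite -[X in _ * X]mulr_natl -[X in _ = X ^+ 2]mulr_natl; ring.
Qed.

(** The best constant is the area of an optimal [P0]. Since [P0] has equal edges, [wirtinger]
    applied to it bounds this constant, hence the ratio of every polygon. *)
Lemma isoperimetric_inequality (R : realType) (n : nat) (P : 'I_n -> R * R) :
  (2 < n)%N ->
  4 * n%:R * sin (pi / n%:R) * area P <= cos (pi / n%:R) * perimeter P ^+ 2.
Proof.
move=> n2; have n0 : (0 < n)%N := ltnW (ltnW n2).
have := sin_pi_div_gt0 R n2; have := cos_pi_div_gt0 R n2.
have [P0 L1 HM] := exists_isoperimetric_constant R n0.
have W := wirtinger P0 n0.
move: W; set c := cos _; set s := sin _ => W c0 s0.
have nR : (0 : R) < n%:R by rewrite ltr0n.
have ns : 0 < 4 * n%:R * s by rewrite !mulr_gt0.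
have L2 := sqr_ge0 (perimeter P).
have [M0|M0] := leP (area P0) 0.
  have : area P <= 0 by apply: le_trans (HM P) _; rewrite mulr_le0_ge0.
  move=> aP; apply: (@le_trans _ _ 0); first by rewrite mulr_ge0_le0 // ltW.
  by rewrite mulr_ge0 // ltW.
have L0 := perimeter_ge0 P0.
(* Optimality tested on [P0] itself gives [area P0 <= area P0 * perimeter P0 ^+ 2], with positive
   area and perimeter at most 1. *)
have LL : perimeter P0 ^+ 2 = 1.
  apply/eqP; rewrite eq_le exprn_ile1 //=.
  by rewrite -(ler_pM2l M0) mulr1 HM.
have eL : n%:R * (\sum_(i < n) edge_length P0 i ^+ 2) = perimeter P0 ^+ 2.
  apply: equilateral_sum_sqr; apply: (optimal_edges_eq (ltnW n2) M0 HM).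
  by rewrite LL mulr1.
have M1 : 4 * n%:R * s * area P0 <= c.
  rewrite -[leRHS]mulr1 -[X in _ <= _ * X]LL -eL [leRHS]mulrCA.
  by rewrite (_ : 4 * n%:R * s * area P0 = n%:R * (4 * s * area P0)) ?ler_pM2l //; ring.
apply: (@le_trans _ _ (4 * n%:R * s * (area P0 * perimeter P ^+ 2))).
  by rewrite ler_pM2l.
by rewrite mulrA ler_wpM2r.
Qed.

(** By the inequality just proved, [P] is optimal for the constant [M]; hence its edges are equal
    and it attains equality in [wirtinger]. *)
Lemma isoperimetric_equality (R : realType) (n : nat) (P : 'I_n -> R * R) :
  (2 < n)%N ->
  4 * n%:R * sin (pi / n%:R) * area P = cos (pi / n%:R) * perimeter P ^+ 2 ->
  exists c a : R[i], forall j, toC (P j) = c + a * unity_root R n ^+ j.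
Proof.
move=> n2; have n0 : (0 < n)%N := ltnW (ltnW n2).
have s0 := sin_pi_div_gt0 R n2; have c0 := cos_pi_div_gt0 R n2.
have nR : (0 : R) < n%:R by rewrite ltr0n.
have ns : 0 < 4 * n%:R * sin (pi / n%:R : R) by rewrite !mulr_gt0.
move=> eP; apply: wirtinger_eq; first exact: ltnW.
pose M : R := cos (pi / n%:R) / (4 * n%:R * sin (pi / n%:R)).
have eL := equilateral_sum_sqr (@optimal_edges_eq R n P M (ltnW n2) _ _ _).
apply: (mulfI (lt0r_neq0 nR)); rewrite [RHS]mulrCA eL.
- by rewrite -eP; ring.
- by rewrite divr_gt0.
- move=> Q; rewrite /M mulrAC ler_pdivlMr // mulrC.
  exact: isoperimetric_inequality.
by rewrite /M mulrAC -eP mulrC mulKf // gt_eqF.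
Qed.

(** * Orbits of a rotation *)

Lemma toCB (R : realType) (u v : R * R) : toC (u - v) = toC u - toC v.
Proof. by []. Qed.

Lemma toC_inj (R : realType) : injective (@toC R).
Proof. by move=> [a b] [c d] [-> ->]. Qed.

Lemma conjcM (R : rcfType) (x y : R[i]) : conjc (x * y) = conjc x * conjc y.
Proof. exact: rmorphM. Qed.

Lemma conjcN (R : rcfType) (x : R[i]) : conjc (- x) = - conjc x.
Proof. exact: rmorphN. Qed.

Lemma conj_toCM (R : realType) (u v : R * R) :
  conjc (toC u) * toC v = (dot u v +i* cross u v)%C.
Proof.
by apply/eqP; rewrite eq_complex /dot /cross /=; apply/andP; split; apply/eqP; ring.
Qed.

Lemma dot_conj (R : realType) (u v : R * R) : dot u v = Re (conjc (toC u) * toC v).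
Proof. by rewrite conj_toCM. Qed.

Lemma cross_conj (R : realType) (u v : R * R) : cross u v = Im (conjc (toC u) * toC v).
Proof. by rewrite conj_toCM. Qed.

Lemma enorm_conj (R : realType) (u : R * R) :
  enorm u = Num.sqrt (Re (conjc (toC u) * toC u)).
Proof. by rewrite conj_toCM /enorm /dot !expr2. Qed.

Section Orbit.
Variables (R : realType) (n : nat) (P : 'I_n -> R * R) (c a v : R[i]).
Hypotheses (vn : v ^+ n = 1) (vJ : conjc v * v = 1).
Hypothesis PE : forall j, toC (P j) = c + a * v ^+ j.

Lemma orbit_ordS j : toC (P (ordS j)) = c + a * v ^+ j * v.
Proof. by rewrite PE expr_mod // exprSr mulrA. Qed.

Lemma orbit_ord_pred j : toC (P (ord_pred j)) = c + a * v ^+ j * conjc v.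
Proof.
have := orbit_ordS (ord_pred j); rewrite ord_predK PE => /addrI ->.
by rewrite PE -!mulrA [v * _]mulrC vJ mulr1.
Qed.

Lemma conjXM k : conjc (v ^+ k) * v ^+ k = 1.
Proof. by rewrite rmorphXn -exprMn vJ expr1n. Qed.

Lemma orbit_edge_length i :
  edge_length P i = Num.sqrt (Re ((conjc a * a) * (conjc (v - 1) * (v - 1)))).
Proof.
rewrite /edge_length enorm_conj toCB orbit_ordS PE; congr (Num.sqrt (Re _)).
rewrite (_ : _ - _ = a * v ^+ i * (v - 1)); last by ring.
rewrite !rmorphM /=.
transitivity ((conjc a * a) * (conjc (v - 1) * (v - 1)) * (conjc (v ^+ i) * v ^+ i)).
  by ring.
by rewrite conjXM mulr1.
Qed.

(** The product of the conjugate outgoing edge and the reversed incoming edge carries their [dot]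
    and [cross]; the factor v^k of modulus 1 cancels in it. *)
Lemma orbit_interior_angle i j : interior_angle P i = interior_angle P j.
Proof.
have key k : conjc (toC (P (ordS k) - P k)) * toC (P (ord_pred k) - P k) =
    (conjc a * a) * (conjc (v - 1) * (conjc v - 1)).
  rewrite !toCB orbit_ordS orbit_ord_pred PE.
  rewrite (_ : _ - _ = a * v ^+ k * (v - 1)); last by ring.
  rewrite (_ : c + a * v ^+ k * conjc v - (c + a * v ^+ k) =
    a * v ^+ k * (conjc v - 1)); last by ring.
  rewrite !rmorphM /=.
  transitivity ((conjc a * a) * (conjc (v - 1) * (conjc v - 1)) *
      (conjc (v ^+ k) * v ^+ k)).
    by ring.
  by rewrite conjXM mulr1.
have key' k : enorm (P (ord_pred k) - P k) = edge_length P (ord_pred k).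
  by rewrite /edge_length ord_predK /enorm /=; congr Num.sqrt; ring.
rewrite /interior_angle /ccw_angle !dot_conj !cross_conj !key !key'.
by rewrite -!/(edge_length P _) !orbit_edge_length.
Qed.

Lemma orbit_area : area P = 2^-1 * n%:R * Re (conjc a * a) * Im v.
Proof.
pose Q := homothety 1 (Re c, Im c) P.
have -> : area P = area Q by rewrite area_homothety expr1n mul1r.
have QE j : toC (Q j) = a * v ^+ j.
  have tr (x : R[i]) (u : R * R) :
      toC (1 * (u.1 - Re x), 1 * (u.2 - Im x)) = toC u - x.
    by case: x => x y; rewrite !mul1r.
  by rewrite /Q /homothety tr PE addrAC subrr add0r.
have QS j : toC (Q (ordS j)) = a * v ^+ j * v.
  by rewrite QE expr_mod // exprSr mulrA.
rewrite /area -2!mulrA; congr (_ * _).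
transitivity (\sum_(i < n) Re (conjc a * a) * Im v).
  apply: eq_bigr => i _; rewrite cross_conj QE QS rmorphM /=.
  rewrite (_ : _ * _ = (conjc a * a) * v * (conjc (v ^+ i) * v ^+ i)); last by ring.
  rewrite conjXM mulr1.
  by case: a v => x y [z t] /=; ring.
by rewrite sumr_const card_ord mulr_natl.
Qed.

End Orbit.

(** Polar form of the angle, which removes the case split on the sign of [cross u v]. Cauchy-Schwarz
    puts the argument of [acos] in [-1, 1]. *)
Lemma cos_ccw_angle (R : realType) (u v : R * R) : u != 0 -> v != 0 ->
  enorm u * enorm v * cos (ccw_angle u v) = dot u v /\
  enorm u * enorm v * sin (ccw_angle u v) = cross u v.
Proof.
move=> u0 v0.
have N0 : 0 < enorm u * enorm v.
  by rewrite mulr_gt0 // lt_neqAle enorm_ge0 andbT eq_sym;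
    [apply: contraNneq u0|apply: contraNneq v0] => /enorm_eq0 ->.
have D1 : `|dot u v / (enorm u * enorm v)| <= 1.
  rewrite normrM normfV (gtr0_norm N0) ler_pdivrMr // mul1r.
  rewrite -(@ler_pXn2r _ 2) ?nnegrE ?(ltW N0) // real_normK ?num_real //.
  by rewrite -sqr_dotDcross lerDl sqr_ge0.
have D2 : -1 <= dot u v / (enorm u * enorm v) <= 1 by rewrite -ler_norml.
have C0 : enorm u * enorm v * cos (acos (dot u v / (enorm u * enorm v))) = dot u v.
  by rewrite acosK ?in_itv //= mulrC mulfVK // gt_eqF.
have S0 : enorm u * enorm v * sin (acos (dot u v / (enorm u * enorm v))) = `|cross u v|.
  rewrite sin_acos // -{1}(gtr0_norm N0) -sqrtr_sqr -sqrtrM ?sqr_ge0 // -sqrtr_sqr.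
  congr Num.sqrt; rewrite mulrBr mulr1 -exprMn [_ * (_ / _)]mulrC mulfVK ?gt_eqF //.
  by rewrite -sqr_dotDcross; ring.
rewrite /ccw_angle; case: ifPn => cr; split => //; first by rewrite S0 ger0_norm.
  rewrite (_ : 2 * pi - _ = - acos (dot u v / (enorm u * enorm v)) + pi *+ 2).
    by rewrite cosD2pi cosN.
  by rewrite mulr2n; ring.
rewrite (_ : 2 * pi - _ = - acos (dot u v / (enorm u * enorm v)) + pi *+ 2).
  by rewrite sinD2pi sinN mulrN S0 ltr0_norm ?opprK // ltNge.
by rewrite mulr2n; ring.
Qed.

(* Equal edges and equal angles make each edge the image of the previous one
   under one fixed rotation [v]. *)
Lemma equilateral_equiangular_orbit (R : realType) (n : nat) (P : 'I_n -> R * R) :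
  (1 < n)%N -> injective P ->
  (forall i j, edge_length P i = edge_length P j) ->
  (forall i j, interior_angle P i = interior_angle P j) ->
  exists c a v : R[i], [/\ v ^+ n = 1, conjc v * v = 1, a != 0 &
    forall j, toC (P j) = c + a * v ^+ j].
Proof.
move=> n1 injP eqL eqA.
have n0 := ltnW n1; pose i0 := Ordinal n0.
pose e i := toC (P (ordS i) - P i).
set l := edge_length P i0; set th := interior_angle P i0.
have eN i : P (ordS i) - P i != 0.
  by rewrite subr_eq0 (inj_eq injP) ordS_neq.
have lN i : enorm (P (ordS i) - P i) = l by exact: eqL.
have l0 : l != 0 by rewrite -(lN i0); apply: contraNneq (eN i0) => /enorm_eq0 ->.
have lC : (l%:C)%C != 0 by rewrite (inj_eq (@complexI _)) .
have ee i : conjc (e i) * e i = (l%:C)%C ^+ 2.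
  rewrite /e conj_toCM /cross mulrC subrr -(lN i) -rmorphXn /= sqr_enorm /dot.
  by rewrite !expr2.
(* The minus sign appears because the interior angle is measured to the reversed incoming edge. *)
have ang i : conjc (e i) * e (ord_pred i) = - ((l%:C)%C ^+ 2 * cis th).
  have pN : P (ord_pred i) - P i != 0.
    by rewrite -opprB oppr_eq0 -{1}(ord_predK i).
  have pl : enorm (P (ord_pred i) - P i) = l.
    rewrite -(lN (ord_pred i)) ord_predK /enorm /=; congr Num.sqrt; ring.
  have [C S] := cos_ccw_angle (eN i) pN.
  rewrite -/(interior_angle P i) (eqA i i0) -/th lN pl in C S.
  rewrite /e ord_predK -[P i - P (ord_pred i)]opprB.
  have -> x : toC (- x) = - toC x :> R[i] by [].
  rewrite mulrN conj_toCM -C -S; congr (- _); rewrite -rmorphXn /cis.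
  by apply/eqP; rewrite eq_complex /= !mul0r subr0 addr0 expr2 !eqxx.
(* Rotation by the exterior angle pi - th. *)
pose v := - conjc (cis th).
have vJ : conjc v * v = 1.
  by rewrite /v conjcN conjcK mulrNN mulrC cis_conj.
have step i : e (ordS i) = v * e i.
  have := ang (ordS i); rewrite ordSK => A.
  apply: (mulfI (expf_neq0 2 lC)); rewrite -{1}(ee i).
  have -> : (l%:C)%C ^+ 2 * (v * e i) = e i * conjc (- ((l%:C)%C ^+ 2 * cis th)).
    by rewrite conjcN conjcM expr2 conjcM conjc_real /v; ring.
  by rewrite -A conjcM conjcK; ring.
have e0 : e i0 != 0.
  apply: contraNneq lC => e00; have := ee i0.
  by rewrite e00 mulr0 => /esym/eqP; rewrite sqrf_eq0.
have eX k (kn : (k < n)%N) : e (Ordinal kn) = v ^+ k * e i0.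
  elim: k kn => [|k IH] kn; first by rewrite mul1r; congr e; exact/val_inj.
  have kn' := ltnW kn.
  rewrite (_ : Ordinal kn = ordS (Ordinal kn')); last first.
    by apply/val_inj; rewrite /= modn_small.
  by rewrite step IH exprS mulrA.
have vn : v ^+ n = 1.
  have nn : (n.-1 < n)%N by rewrite prednK.
  apply: (mulIf e0); rewrite mul1r -[X in v ^+ X](prednK n0) exprS -mulrA -eX -step.
  by congr e; apply/val_inj; rewrite /= prednK // modnn.
have eXo i : e i = v ^+ i * e i0 by case: i => k kn; exact: eX.
(* With v = 1 all edges would be the same nonzero vector, and the polygon would not close up. *)
have v1 : v - 1 != 0.
  rewrite subr_eq0; apply/negP => /eqP v1.
  have : \sum_(i < n) e i = 0.
    rewrite /e; under eq_bigr do rewrite toCB.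
    by rewrite sumrB (sum_ordS (fun i => toC (P i))) subrr.
  under eq_bigr do rewrite eXo v1 expr1n mul1r.
  rewrite sumr_const card_ord -mulr_natl => /eqP.
  by rewrite mulf_eq0 (negbTE e0) orbF pnatr_eq0 -leqn0 leqNgt n0.
(* The edge from c + a to c + a v must be [e i0]; this determines the center. *)
pose a := e i0 / (v - 1).
have a1 : a * (v - 1) = e i0 by rewrite /a mulfVK.
exists (toC (P i0) - a), a, v; split=> //.
  by rewrite mulf_neq0 // invr_eq0.
apply: (@ord_ind_cyclic _ _ i0) => // [|i IH]; first by rewrite /= mulr1 subrK.
rewrite /= expr_mod // exprS.
have -> : toC (P (ordS i)) = toC (P i) + e i by rewrite /e toCB addrC subrK.
by rewrite IH eXo -a1; ring.
Qed.

(** * The regular polygon is simple *)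

Lemma Re_conjM_ge0 (R : rcfType) (a : R[i]) : 0 <= Re (conjc a * a).
Proof. by case: a => x y /=; rewrite mulNr opprK -!expr2 addr_ge0 ?sqr_ge0. Qed.

Lemma conjME (R : rcfType) (a : R[i]) : conjc a * a = ((Re (conjc a * a))%:C)%C.
Proof.
case: a => x y /=; apply/eqP; rewrite eq_complex /= eqxx /=.
by apply/eqP; ring.
Qed.

Lemma cis_chord (R : realType) (x : R) :
  Re (conjc (cis (x *+ 2) - 1) * (cis (x *+ 2) - 1)) = (2 * sin x) ^+ 2.
Proof.
rewrite /= sin_mulr2n cos_mulr2n !mulr2n.
have := cos2sin2 x; set s := sin _; set k := cos _ => e.
transitivity (4 * (k ^+ 2 - 1) ^+ 2 + 4 * k ^+ 2 * s ^+ 2); first by ring.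
by rewrite e; ring.
Qed.

(** With t = pi/n, the edges have length 2 |a| sin t and the area is n |a|^2 sin t cos t, so both
    sides equal 4 n^2 |a|^2 sin^2 t cos t. *)
Lemma regular_isoperimetric_equality (R : realType) (n : nat)
    (P : 'I_n -> R * R) (c a : R[i]) : (0 < n)%N ->
  (forall j, toC (P j) = c + a * unity_root R n ^+ j) ->
  4 * n%:R * sin (pi / n%:R) * area P = cos (pi / n%:R) * perimeter P ^+ 2.
Proof.
move=> n0 PE.
have wn := prim_expr_order (unity_root_prim R n0).
have wJ : conjc (unity_root R n) * unity_root R n = 1 := cis_conj _.
rewrite (orbit_area wn wJ PE) /perimeter.
under eq_bigr do rewrite (orbit_edge_length wn wJ PE).
rewrite sumr_const card_ord -[X in X ^+ 2]mulr_natl exprMn.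
have Ea := conjME a; have := Re_conjM_ge0 a.
move: Ea; set A := Re (conjc a * a) => Ea A0.
rewrite Ea Re_real_complexM /unity_root (_ : 2 * _ = (pi / n%:R) *+ 2); last first.
  by rewrite mulr2n; ring.
rewrite cis_chord (sqr_sqrtr (mulr_ge0 A0 (sqr_ge0 _))) /= sin_mulr2n mulr2n.
by field.
Qed.

Definition regular_vertices (R : realType) (n : nat) (r : R) (j : 'I_n) : R * R :=
  (r * cos (j%:R * (2 * (pi / n%:R))), r * sin (j%:R * (2 * (pi / n%:R)))).

Lemma toC_regular_vertices (R : realType) (n : nat) (r : R) (j : 'I_n) :
  toC (regular_vertices r j) = 0 + (r%:C)%C * unity_root R n ^+ j.
Proof.
rewrite add0r /unity_root cisX; apply/eqP; rewrite eq_complex /=.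
by rewrite !mul0r subr0 addr0 !eqxx.
Qed.

Lemma sin_unity_order (R : realType) n : (0 < n)%N ->
  sin (n%:R * (pi / n%:R)) = 0 :> R.
Proof. by move=> n0; rewrite mulrC mulfVK ?sinpi // pnatr_eq0 -lt0n. Qed.

(* Distance, up to the factor [2 r], from vertex [j] of the regular polygon to
   the line carrying the edge [i]. *)
Definition support_gap (R : realType) (n : nat) (i j : 'I_n) : R :=
  sin ((j%:R - i%:R) * (pi / n%:R)) * sin ((j%:R - i%:R - 1) * (pi / n%:R)).

(** Convexity: all vertices lie on one side of the line carrying the edge [i]. For j < i both sines
    change sign. *)
Lemma support_gap_ge0 (R : realType) (n : nat) (i j : 'I_n) :
  0 <= support_gap R i j.
Proof.
rewrite /support_gap; have [ij|ji] := leqP i j.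
  by rewrite -natrB // wirtinger_coef_ge0 // (leq_ltn_trans (leq_subr _ _)).
have e : (i%:R : R) = (i - j)%N%:R + j%:R by rewrite -natrD subnK // ltnW.
set m := (i - j)%N in e; have m0 : (0 < m)%N by rewrite subn_gt0.
have mn : (m < n)%N by rewrite (leq_ltn_trans (leq_subr _ _)).
rewrite (_ : (_ - _) * _ = - (m%:R * (pi / n%:R))); last by rewrite e; ring.
rewrite (_ : (_ - _ - 1) * _ = - (m.+1%:R * (pi / n%:R))); last by rewrite e -natr1; ring.
rewrite !sinN mulrNN mulr_ge0 //; first by rewrite ltW // sin_unity_gt0 // m0.
have := mn; rewrite leq_eqVlt => /orP[/eqP <-|mn']; last first.
  by rewrite ltW // sin_unity_gt0.
by rewrite sin_unity_order.
Qed.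

Lemma support_gap_eq0 (R : realType) (n : nat) (i j : 'I_n) :
  (support_gap R i j == 0) = (j == i) || (j == ordS i).
Proof.
apply/idP/idP; last first.
  case/orP=> /eqP ->; rewrite /support_gap; first by rewrite subrr mul0r sin0 mul0r.
  rewrite /=; have := ltn_ord i; rewrite leq_eqVlt => /orP[/eqP e|lt].
    have n0 : (0 < n)%N by rewrite -e.
    rewrite e modnn (_ : (0%:R - i%:R - 1) * (pi / n%:R) = - (n%:R * (pi / n%:R))).
      by rewrite sinN sin_unity_order // oppr0 mulr0.
    have en : n%:R = i%:R + 1 :> R by rewrite natr1 e.
    by rewrite -mulNr; congr (_ * _); rewrite en; ring.
  by rewrite modn_small // -natr1 addrAC subrr add0r subrr mul0r sin0 mulr0.
rewrite /support_gap; have [ij|ji] := leqP i j.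
  rewrite -natrB //; case E : (j - i)%N => [|[|m]].
  - move=> _; apply/orP; left; apply/eqP/val_inj/eqP.
    by rewrite eqn_leq ij -subn_eq0 E.
  - move=> _; apply/orP; right; apply/eqP/val_inj; rewrite /= modn_small.
      by rewrite -(subnKC ij) E addn1.
    by rewrite -[X in (X < _)%N]addn1 -E subnKC // .
  - rewrite gt_eqF // wirtinger_coef_gt0 //= -E.
    by rewrite (leq_ltn_trans (leq_subr _ _)).
have e : (i%:R : R) = (i - j)%N%:R + j%:R by rewrite -natrD subnK // ltnW.
set m := (i - j)%N in e; have m0 : (0 < m)%N by rewrite subn_gt0.
have mn : (m < n)%N by rewrite (leq_ltn_trans (leq_subr _ _)).
rewrite (_ : (_ - _) * _ = - (m%:R * (pi / n%:R))); last by rewrite e; ring.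
rewrite (_ : (_ - _ - 1) * _ = - (m.+1%:R * (pi / n%:R))); last by rewrite e -natr1; ring.
have := mn; rewrite leq_eqVlt => /orP[/eqP mn'|mn']; last first.
  by rewrite !sinN mulrNN gt_eqF // mulr_gt0 // sin_unity_gt0 // m0.
move=> _; apply/orP; right; apply/eqP/val_inj => /=.
(* Wrap-around: i - j = n - 1 forces the last edge and its endpoint, vertex 0. *)
have iN : i.+1 = n by have := ltn_ord i; rewrite /m in mn'; lia.
rewrite iN modnn; rewrite /m in mn'; lia.
Qed.

(** Scalar product with the outer unit normal of the edge [i] of the regular polygon centered at the
    origin, of direction (2 i + 1) pi/n. *)
Definition support_fun (R : realType) (n : nat) (i : 'I_n) (u : R * R) : R :=
  u.1 * cos ((2 * i%:R + 1) * (pi / n%:R)) + u.2 * sin ((2 * i%:R + 1) * (pi / n%:R)).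

Lemma support_fun_vertex (R : realType) (n : nat) (r : R) (i j : 'I_n) :
  support_fun i (regular_vertices r j) =
  r * cos (pi / n%:R) - 2 * r * support_gap R i j.
Proof.
rewrite /support_fun /support_gap /=; set t := pi / _.
set x := (j%:R - i%:R) * t.
have -> : (j%:R - i%:R - 1) * t = x - t by rewrite /x; ring.
have -> : j%:R * (2 * t) = (2 * i%:R + 1) * t + (x *+ 2 - t) by rewrite /x; ring.
set y := (2 * _ + 1) * t.
rewrite (cosD y) (sinD y).
transitivity (r * cos (x *+ 2 - t) * (cos y ^+ 2 + sin y ^+ 2)); first by ring.
rewrite cos2Dsin2 mulr1 cosB sinB cos_mulr2n sin_mulr2n !mulr2n.
have := cos2Dsin2 x; set k := cos x; set s := sin x => e.
have -> : k ^+ 2 = 1 - s ^+ 2 by rewrite -e; ring.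
by ring.
Qed.

Definition lerp (R : realType) (tau : R) (u v : R * R) : R * R :=
  ((1 - tau) * u.1 + tau * v.1, (1 - tau) * u.2 + tau * v.2).

Lemma support_fun_lerp (R : realType) (n : nat) (i : 'I_n) (tau : R) u v :
  support_fun i (lerp tau u v) =
  (1 - tau) * support_fun i u + tau * support_fun i v.
Proof. by rewrite /support_fun /=; ring. Qed.

(** On the edge [i] the support function equals the apothem, so the weighted gaps of the endpoints
    of the edge [j] sum to 0. Each is nonnegative: every endpoint has weight 0 or lies on the edge
    [i]. *)
Lemma regular_edges_meet (R : realType) (n : nat) (r : R) (i j : 'I_n) (tau : R) :
  0 < r -> 0 <= tau <= 1 ->
  edge (regular_vertices r) i
    (lerp tau (regular_vertices r j) (regular_vertices r (ordS j))) ->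
  [|| tau == 1, j == i | j == ordS i] /\
  [|| tau == 0, ordS j == i | ordS j == ordS i].
Proof.
move=> r0 /andP[t0 t1] [s _ /(congr1 (support_fun i))].
rewrite -/(lerp s _ _) !support_fun_lerp !support_fun_vertex.
have /eqP -> : support_gap R i i == 0 by rewrite support_gap_eq0 eqxx.
have /eqP -> : support_gap R i (ordS i) == 0 by rewrite support_gap_eq0 eqxx orbT.
move=> e.
have : (1 - tau) * support_gap R i j + tau * support_gap R i (ordS j) = 0.
  have r2 : 2 * r != 0 by rewrite mulf_neq0 // gt_eqF.
  apply: (mulfI r2); rewrite mulr0; lra.
move/eqP; rewrite paddr_eq0; last 2 first.
- by apply: mulr_ge0; rewrite ?subr_ge0 ?support_gap_ge0.
- by apply: mulr_ge0; rewrite ?support_gap_ge0.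
rewrite (mulf_eq0 (1 - tau)) (mulf_eq0 tau) !support_gap_eq0 subr_eq0.
by rewrite [1 == _]eq_sym => /andP[].
Qed.

Lemma ordSS_neq (n : nat) (i : 'I_n) : (2 < n)%N -> ordS (ordS i) != i.
Proof.
move=> n2; rewrite -val_eqE /= -addn1 modnDml addn1.
have := ltn_ord i; rewrite leq_eqVlt => /orP[/eqP e|].
  by rewrite -{1}addn1 e -modnDml modnn add0n modn_small ?(ltnW n2) //; apply/eqP; lia.
rewrite leq_eqVlt => /orP[/eqP e|lt].
  by rewrite e modnn; apply/eqP; lia.
by rewrite modn_small //; apply/eqP; lia.
Qed.

Lemma regular_vertices_inj (R : realType) (n : nat) (r : R) : 0 < r ->
  injective (@regular_vertices R n r).
Proof.
move=> r0 i j /(congr1 (@toC R)); rewrite !toC_regular_vertices => /addrI.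
have n0 : (0 < n)%N by apply: leq_ltn_trans (ltn_ord i).
have rC : (r%:C)%C != 0 by rewrite (inj_eq (@complexI _)) gt_eqF.
move/(mulfI rC)/eqP; rewrite (eq_prim_root_expr (unity_root_prim R n0)).
by rewrite !modn_small // => /eqP/val_inj.
Qed.

Lemma area_regular_vertices (R : realType) (n : nat) (r : R) : (0 < n)%N ->
  area (@regular_vertices R n r) =
  n%:R * sin (pi / n%:R) * cos (pi / n%:R) * r ^+ 2.
Proof.
move=> n0; have wn := prim_expr_order (unity_root_prim R n0).
have wJ : conjc (unity_root R n) * unity_root R n = 1 := cis_conj _.
rewrite (orbit_area wn wJ (@toC_regular_vertices R n r)).
rewrite /unity_root (_ : 2 * _ = (pi / n%:R) *+ 2); last by rewrite mulr2n; ring.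
by rewrite /= sin_mulr2n; field.
Qed.

Lemma simple_regular_vertices (R : realType) (n : nat) (r : R) : (2 < n)%N ->
  0 < r -> simple_ngon (@regular_vertices R n r).
Proof.
move=> n2 r0; have n0 := ltnW (ltnW n2).
split; first exact: regular_vertices_inj.
- move=> i; apply/seteqP; split=> [x [xi [tau tau01 xE]]|x ->].
    have {}xE : lerp tau (regular_vertices r (ordS i))
        (regular_vertices r (ordS (ordS i))) = x by [].
    (* Vertex i + 2 differs from i and i + 1 as n > 2, so its weight is 0 and the common point is
       vertex i + 1. *)
    rewrite -xE in xi; have [_] := regular_edges_meet r0 tau01 xi.
    rewrite (negbTE (ordSS_neq i n2)) (negbTE (ordS_neq (ordS i) (ltnW n2))) !orbF.
    move=> /eqP tau0; rewrite /= -xE /lerp tau0 subr0 !mul1r !mul0r !addr0.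
    by rewrite -surjective_pairing.
  split; [exists 1|exists 0] => /=; rewrite ?lexx ?ler01 //.
    by rewrite subrr !mul0r !mul1r !add0r.
  by rewrite subr0 !mul0r !mul1r !addr0.
- move=> i j ji jSi iSj; apply/seteqP; split=> // x [xi [tau tau01 xE]].
  have {}xE : lerp tau (regular_vertices r j) (regular_vertices r (ordS j)) = x by [].
  rewrite -xE in xi; have [] := regular_edges_meet r0 tau01 xi.
  rewrite (negbTE ji) (negbTE jSi) !orbF => /eqP ->.
  by rewrite oner_eq0 /= (inj_eq (@ordS_inj n)) (negbTE ji) orbF eq_sym (negbTE iSj).
rewrite area_regular_vertices // !mulr_gt0 ?exprn_gt0 ?ltr0n //.
  exact: sin_pi_div_gt0.
exact: cos_pi_div_gt0.
Qed.

Lemma toC_lerp (R : realType) (tau : R) (u v : R * R) :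
  toC (lerp tau u v) = ((1 - tau)%:C)%C * toC u + (tau%:C)%C * toC v.
Proof.
apply/eqP; rewrite eq_complex /=; apply/andP; split; apply/eqP; ring.
Qed.

(** * Star polygons *)

Lemma one_sub_cis (R : realType) (x : R) :
  1 - cis (x *+ 2) = (0 -i* (2 * sin x))%C * cis x.
Proof.
apply/eqP; rewrite eq_complex /= cos_mulr2n sin_mulr2n cos2sin2 !mulr2n.
by apply/andP; split; apply/eqP; ring.
Qed.

(** Both differences are real multiples of -2i e^(i (k + 2) t), with factors sin((k + 2) t) and
    sin(k t): they are parallel chords of the unit circle. *)
Lemma star_crossing (R : realType) (n k : nat) (w : R[i]) (t : R) :
  w = unity_root R n -> t = pi / n%:R ->
  ((sin (k%:R * t))%:C)%C * (1 - w ^+ k.+2) =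
  ((sin (k.+2%:R * t))%:C)%C * (w - w ^+ k.+1).
Proof.
move=> ew et.
have wX j : w ^+ j = cis ((j%:R * t) *+ 2).
  by rewrite ew cisX -et; congr cis; rewrite mulr2n; ring.
rewrite (_ : w - w ^+ k.+1 = w * (1 - w ^+ k)); last by rewrite exprS; ring.
rewrite !wX !one_sub_cis ew /unity_root -et.
have -> : cis (k.+2%:R * t) = cis (2 * t) * cis (k%:R * t).
  by rewrite -cisD -addn2 natrD; congr cis; ring.
apply/eqP; rewrite eq_complex /=.
by apply/andP; split; apply/eqP; ring.
Qed.

(** As v is primitive, w = v^s for some s. The edge 0, from 1 to v, and the edge [s], from w to w v,
    are not adjacent and cross (up to the similarity given by [c] and [a]). *)
Lemma star_not_simple (R : realType) (n m : nat) (P : 'I_n -> R * R)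
    (c a v : R[i]) : (1 < m)%N -> (m.*2 < n)%N ->
  n.-primitive_root v -> v = unity_root R n ^+ m ->
  (forall j, toC (P j) = c + a * v ^+ j) -> ~ simple_ngon P.
Proof.
move=> m1 mn vp vw PE [_ _ disj _].
have n0 : (0 < n)%N by lia.
set w := unity_root R n in vw.
have wp : n.-primitive_root w := unity_root_prim R n0.
have [s ws] := prim_rootP vp (prim_expr_order wp).
have vn := prim_expr_order vp.
pose i0 : 'I_n := Ordinal n0.
have s0 : s != i0.
  apply/eqP => s0; move: ws; rewrite s0 expr0 -[w]expr1 -(expr0 w) => /eqP.
  by rewrite (eq_prim_root_expr wp) mod0n modn_small //; lia.
have s1 : s != ordS i0.
  apply/eqP => s1; move: ws; rewrite s1 /= expr_mod // expr1 vw -{1}[w]expr1 => /eqP.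
  by rewrite (eq_prim_root_expr wp) !modn_small; lia.
have s2 : i0 != ordS s.
  apply/eqP => s2; have : v ^+ ordS s = 1 by rewrite -s2.
  rewrite /= expr_mod // exprSr -ws vw -exprS -(expr0 w) => /eqP.
  by rewrite (eq_prim_root_expr wp) !modn_small; lia.
pose t : R := pi / n%:R.
pose p : R := sin (m.+1%:R * t); pose q : R := sin (m.-1%:R * t).
have p0 : 0 < p by apply: sin_unity_gt0; lia.
have q0 : 0 < q by apply: sin_unity_gt0; lia.
(* By [star_crossing], q (1 - w v) = p (w - v), that is q + p v = p w + q w v; dividing by p + q
   gives a point of both edges. *)
pose tau := p / (p + q).
have pq : 0 < p + q by exact: addr_gt0.
have tau01 : 0 <= tau <= 1.
  apply/andP; split; first by apply: divr_ge0; exact: ltW.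
  by rewrite ler_pdivrMr // mul1r lerDl ltW.
have : (edge P i0 `&` edge P s) (lerp tau (P i0) (P (ordS i0))).
  split; first by exists tau.
  exists (1 - tau) => /=; first by move: tau01; rewrite subr_ge0 lerBlDr lerDl andbC.
  rewrite -/(lerp (1 - tau) (P s) (P (ordS s))); apply: toC_inj.
  rewrite !toC_lerp !(orbit_ordS vn PE) !PE -ws /= expr0 mulr1.
  have -> : 1 - (1 - tau) = tau by ring.
  have key : ((1 - tau)%:C)%C * (1 - w * v) = (tau%:C)%C * (w - v).
    have := @star_crossing R n m.-1 w t erefl erefl; rewrite prednK ?(ltnW m1) // -/p -/q.
    rewrite exprS -vw => e.
    have -> : 1 - tau = (p + q)^-1 * q by rewrite /tau; field; rewrite gt_eqF.
    have -> : tau = (p + q)^-1 * p by rewrite /tau mulrC.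
    by rewrite !rmorphM /= -mulrA e mulrA.
  have -> : (tau%:C)%C * (c + a * v) =
      (tau%:C)%C * (c + a * w) - a * ((tau%:C)%C * (w - v)).
    by ring.
  rewrite -key rmorphB rmorph1; ring.
by rewrite disj.
Qed.

(** * Regular polygons and minimizers *)

Lemma regular_ngon_root (R : realType) (n : nat) (P : 'I_n -> R * R) :
  (2 < n)%N -> regular_ngon P ->
  exists c a : R[i], forall j, toC (P j) = c + a * unity_root R n ^+ j.
Proof.
move=> n2 [simP eqL eqA]; have n0 : (0 < n)%N by lia.
have [injP _ _ aP] := simP.
have [c [a [v [vn vJ a0 PE]]]] :=
  equilateral_equiangular_orbit (ltnW n2) injP eqL eqA.
(* A smaller order [d] would make the vertices [d] and 0 coincide. *)
have vp : n.-primitive_root v.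
  have [d vd dn] := prim_order_exists n0 vn.
  have d0 := prim_order_gt0 vd.
  have := dvdn_leq n0 dn; rewrite leq_eqVlt => /orP[/eqP <- //|lt].
  have : P (Ordinal lt) = P (Ordinal n0).
    by apply: toC_inj; rewrite !PE /= (prim_expr_order vd).
  by move/injP/(congr1 val) => /= d00; rewrite d00 in d0.
have [[m mn] /= vw] := prim_rootP (unity_root_prim R n0) vn.
have : 0 < Im v.
  move: aP; rewrite (orbit_area vn vJ PE).
  rewrite pmulr_rgt0 //; rewrite lt_neqAle eq_sym; apply/andP; split.
    rewrite !mulf_neq0 ?invr_eq0 ?pnatr_eq0 -?lt0n //.
    apply/eqP => A0; move/eqP: a0; apply.
    have := conjME a; rewrite A0 => /eqP; rewrite mulf_eq0 conjc_eq0 orbb.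
    by move/eqP.
  by rewrite mulr_ge0 ?Re_conjM_ge0 // mulr_ge0 // invr_ge0.
rewrite vw /unity_root cisX /= => im.
have m2 : (m.*2 < n)%N.
  rewrite ltnNge; apply/negP => nm; move: im; apply/negP; rewrite -leNgt.
  (* If n <= 2m, the argument of v lies in [pi, 2 pi[, where the sine is nonpositive. *)
  rewrite (_ : _ * _ = (m.*2 - n)%N%:R * (pi / n%:R) + pi); last first.
    rewrite natrB // -mul2n natrM; field.
    by rewrite pnatr_eq0 -lt0n.
  rewrite sinDpi oppr_le0.
  have [->|k0] := posnP (m.*2 - n)%N; first by rewrite mul0r sin0.
  by rewrite ltW // sin_unity_gt0 //; lia.
case: m mn vw im m2 => [|[|m]] mn vw im m2.
- by move: im; rewrite mul0r sin0 ltxx.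
- by exists c, a => j; rewrite PE vw expr1.
by case: (star_not_simple _ m2 vp vw PE simP).
Qed.

Lemma optimal_ngon_minimum (R : realType) (n : nat) (A0 : R)
    (P : 'I_n -> R * R) : (2 < n)%N -> simple_ngon P -> area P = A0 ->
  4 * n%:R * sin (pi / n%:R) * area P = cos (pi / n%:R) * perimeter P ^+ 2 ->
  is_minimum (perimeters n A0) (perimeter P).
Proof.
move=> n2 sP aP eP; split; first by exists P.
move=> _ [Q [_ aQ] <-].
have := isoperimetric_inequality Q n2; rewrite aQ -aP eP.
rewrite ler_pM2l ?cos_pi_div_gt0 // ler_pXn2r //; exact: perimeter_ge0.
Qed.

Theorem mainTheorem1 (R : realType) (n : nat) (A0 : R)
    (hn : (3 <= n)%N) (hA0 : 0 < A0) :
  (exists m : R, is_minimum (perimeters n A0) m) /\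
  (forall Pstar : 'I_n -> R * R,
     simple_ngon Pstar -> area Pstar = A0 ->
     (is_minimum (perimeters n A0) (perimeter Pstar) <-> regular_ngon Pstar)).
Proof.
have n0 : (0 < n)%N by lia.
have s0 := sin_pi_div_gt0 R hn; have c0 := cos_pi_div_gt0 R hn.
pose b : R := n%:R * sin (pi / n%:R) * cos (pi / n%:R).
have b0 : 0 < b by rewrite !mulr_gt0 // ltr0n.
(* [b] is the area of the regular polygon of circumradius 1, so this radius gives area [A0]. *)
pose r := Num.sqrt (A0 / b).
have r0 : 0 < r by rewrite sqrtr_gt0 divr_gt0.
pose P0 := @regular_vertices R n r.
have sP0 : simple_ngon P0 by exact: simple_regular_vertices.
have aP0 : area P0 = A0.
  rewrite area_regular_vertices // -/b sqr_sqrtr ?ltW ?divr_gt0 //.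
  by rewrite mulrC mulfVK // gt_eqF.
have eP0 := regular_isoperimetric_equality n0 (@toC_regular_vertices R n r).
have minP0 := optimal_ngon_minimum hn sP0 aP0 eP0.
split; first by exists (perimeter P0).
move=> P sP aP; split=> [[_ minP]|regP]; last first.
  have [c [a PE]] := regular_ngon_root hn regP.
  exact: optimal_ngon_minimum (regular_isoperimetric_equality n0 PE).
(* Two minimizers have the same perimeter, so [P] inherits from [P0] equality in the isoperimetric
   inequality. *)
have LP : perimeter P = perimeter P0.
  apply/eqP; rewrite eq_le; apply/andP; split.
    by apply: minP; case: minP0.
  by apply: minP0.2; exists P.
have [|c [a PE]] := @isoperimetric_equality R n P hn.
  by rewrite LP aP -aP0.
have wn := prim_expr_order (unity_root_prim R n0).
have wJ : conjc (unity_root R n) * unity_root R n = 1 := cis_conj _.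
split=> // i j; first by rewrite !(orbit_edge_length wn wJ PE).
exact: orbit_interior_angle wn wJ PE i j.
Qed.
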